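(* Let $m$ be an integer greater than $1$, and let $\wp$ be an odd prime such that $3$ is a primitive root modulo $\wp^m$. Let $q=3^{\phi(\wp^m)}$ and $D=\{x\in\mathbb{F}_q^*:\ {\rm Tr}(x^{\frac{q-1}{\wp^m}})=0\}$. Then the dual code $\mathcal{C}_D^{\perp}$ of the two-weight code $\mathcal{C}_D$ is a ternary code with parameters $\left[n,\ n-\wp^{m-1}(\wp-1),\ 2\right]$, where $$n=\begin{cases}\frac{q-1}{\wp^m}(\wp^m-\wp+1),&\text{if }\wp\equiv 1\pmod 3,\\ \frac{q-1}{\wp^m}(\wp^m-\wp),&\text{if }\wp\equiv -1\pmod 3.\end{cases}$$
   Context: $\phi$ is Euler's totient function and ${\rm Tr}$ is the trace from $\mathbb{F}_q$ onto $\mathbb{F}_3$. For $D=\{d_1,\ldots,d_n\}\subseteq\mathbb{F}_q^*$ (with $n=\#D$), $\mathcal{C}_D=\{({\rm Tr}(d_1x),\ldots,{\rm Tr}(d_nx)):\ x\in\mathbb{F}_q\}\subseteq\mathbb{F}_3^n$. The dual code $\mathcal{C}_D^{\perp}$ is the set of vectors of $\mathbb{F}_3^n$ orthogonal to all codewords of $\mathcal{C}_D$ under the standard bilinear form. A ternary code with parameters $[n,k,d]$ is a $k$-dimensional linear subspace of $\mathbb{F}_3^n$ with minimum Hamming distance $d$. *)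

(* Defs.v *)
From mathcomp Require Export all_boot all_order all_fingroup all_algebra.
From mathcomp Require Export all_solvable all_field.

Set Implicit Arguments.
Unset Strict Implicit.
Unset Printing Implicit Defensive.

Import GRing.Theory.
Local Open Scope ring_scope.

(* For N > 1; the ring 'Z_N is Z/NZ only in that case. *)
Definition primitive_root_mod (g N : nat) : Prop :=
  exists2 u : {unit 'Z_N}, val u = g%:R & generator (units_Zp N) u.

Section Trace.

Variables (F : finFieldType) (charF : 3%N \in [pchar F]).

(* F with its structure of extension of its prime field 'F_3. *)
Local Notation K := (pPrimeCharType charF).

(* [galTrace] takes its values in the line 1%VS of K; taking the coordinate
   along the basis (1) identifies this line with 'F_3, see [tr3E]. *)
Definition tr3 (x : F) : 'F_3 :=
  coord [tuple (1 : K)] ord0 (galTrace 1%AS {:K} (x : K)).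

Lemma tr3E (x : F) : (tr3 x)%:A = galTrace 1%AS {:K} (x : K) :> K.
Proof.
have galK : galois 1%AS {:K}.
  exact: (finField_galois (sub1v _)).
have := mem_galTrace galK (memvf (x : K)); case/vlineP=> a Da.
rewrite /tr3 Da linearZ /= (coord_free ord0 ord0) ?eqxx ?mulr1 //.
by rewrite free_cons span_nil memv0 oner_eq0 nil_free.
Qed.

(* The coordinates of the ambient space are indexed by the enumeration
   [enum_val] of D. *)
Definition trace_codeword (D : {set F}) (x : F) : 'rV['F_3]_#|D| :=
  \row_(i < #|D|) tr3 (enum_val i * x).

Definition trace_code (D : {set F}) : {set 'rV['F_3]_#|D|} :=
  [set trace_codeword D x | x : F].

End Trace.

Section Codes.

Variable N : nat.
Implicit Types (C : {set 'rV['F_3]_N}) (u v : 'rV['F_3]_N).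

Definition dual_code C : {set 'rV['F_3]_N} :=
  [set u : 'rV['F_3]_N | [forall v in C, \sum_(i < N) u 0 i * v 0 i == 0]].

Definition hamming_dist u v : nat := #|[set i : 'I_N | u 0 i != v 0 i]|.

Definition has_min_dist C (d : nat) : Prop :=
  (exists u v, [/\ u \in C, v \in C, u != v & hamming_dist u v = d]) /\
  (forall u v, u \in C -> v \in C -> u != v -> (d <= hamming_dist u v)%N).

Definition ternary_code C (n k d : nat) : Prop :=
  [/\ N = n,
      exists V : {vspace 'rV['F_3]_N}, C = [set u : 'rV['F_3]_N in V] /\ \dim V = k
    & has_min_dist C d].

End Codes.

(* Main.v *)
From HB Require Import structures.
Require Import Defs.
From mathcomp Require Import zify.
Set Implicit Arguments.
Unset Strict Implicit.
Unset Printing Implicit Defensive.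
Import GRing.Theory VectorInternalTheory.
Local Open Scope ring_scope.

(** Write N = p^m and q - 1 = k N.  For x nonzero, z = x^k satisfies z^N = 1,
    and as i runs over the exponents below totient N, the powers 3^i run exactly
    once over the units modulo N, because 3 is a primitive root.  Hence the
    trace of z, the sum of its conjugates z^(3^i), is the sum of z^u over the
    units u modulo N: the sum over all residues minus the sum over the multiples
    of p.  Both are geometric sums of roots of unity, so that
      Tr(z) = N [z = 1] - (N/p) [z^p = 1]
    ([sum_conj_unity_root]).  Since 3 does not divide p, this vanishes iff
    z^p <> 1, or z = 1 and p = 1 mod 3.  As x^j = 1 has exactly j solutions in F
    for each j dividing q - 1, the size of D is q - 1 - k p, plus k if
    p = 1 mod 3 ([card_tr3_power_eq0]).

    The remaining parameters follow from the trace being nonzero and D being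
    large, stable under negation and free of 0.  If Tr(d x) = 0 for all d in D
    and some nonzero x, then D lies in a proper additive subgroup, of index at
    least 2; but D fills at least half of F, although 0 is not in D.  So
    x |-> (Tr(d x))_d is injective and the trace code has dimension
    [F : F_3] = totient N ([dim_dual_trace_code]).  No coordinate of the trace
    code vanishes identically, so the dual has no word of weight 1, whereas
    d and -d in D give a dual word of weight 2
    ([min_dist_dual_trace_code]). *)

(** * Sums over powers of a primitive root *)

Lemma sum_cycle (gT : finGroupType) (V : nmodType) (x : gT) (f : gT -> V) :
  \sum_(y in <[x]>%g) f y = \sum_(i < #[x]%g) f (x ^+ i)%g.
Proof.
have defx : <[x]>%g = [set (x ^+ val i)%g | i in 'I_#[x]%g].
  apply/setP=> y; apply/idP/imsetP => [/cyclePmin[i lti ->]|[i _ ->]].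
    by exists (Ordinal lti).
  exact: mem_cycle.
rewrite [in LHS]defx big_imset //= => i j _ _ /eqP.
by rewrite eq_expg_mod_order !modn_small // => /eqP/val_inj.
Qed.

(** Translates the group of units of 'Z_N, over which the primitive root
    hypothesis speaks, into a sum indexed by ordinary residues. *)
Lemma sum_units_Zp (V : nmodType) (N : nat) (f : nat -> V) : (1 < N)%N ->
  \sum_(u in units_Zp N) f (val u) = \sum_(k < N | coprime N k) f k.
Proof.
move=> N_gt1.
rewrite (eq_bigl xpredT) => [|u]; last by rewrite inE.
transitivity (\sum_(x : 'Z_N | x \is a GRing.unit) f x).
  rewrite (reindex_omap (val : {unit 'Z_N} -> 'Z_N) insub) => [|x Ux].
    apply: eq_bigl => u /=.
    by rewrite (valP u) valK eqxx.
  by rewrite insubT.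
rewrite (eq_bigl (fun x : 'Z_N => coprime N x)) => [|x]; last first.
  by rewrite qualifE /= {1}Zp_cast.
by rewrite -2!(big_mkord (coprime N) f) Zp_cast.
Qed.

Lemma sum_powers_primitive_root (V : nmodType) (g N : nat) (f : nat -> V) :
  (1 < N)%N -> primitive_root_mod g N ->
  \sum_(i < totient N) f (g ^ i %% N)%N = \sum_(k < N | coprime N k) f k.
Proof.
move=> N_gt1 [u val_u /eqP gen_u].
rewrite -sum_units_Zp // gen_u sum_cycle.
have -> : #[u]%g = totient N by rewrite orderE -gen_u card_units_Zp // ltnW.
apply: eq_bigr => i _; congr f.
by rewrite FinRing.val_unitX val_u -natrX val_Zp_nat.
Qed.

Lemma sum_unity_root_expr (K : fieldType) (n : nat) (z : K) : z ^+ n = 1 ->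
  \sum_(i < n) z ^+ i = if z == 1 then n%:R else 0.
Proof.
move=> zn1; case: eqP => [->|/eqP z_neq1].
  by under eq_bigr do rewrite expr1n; rewrite sumr_const card_ord.
apply/eqP; move/eqP: (subrX1 z n); rewrite zn1 subrr eq_sym mulf_eq0.
by rewrite subr_eq0 (negPf z_neq1).
Qed.

Lemma sum_coprime_prime_power (V : zmodType) (p m : nat) (f : nat -> V) :
    prime p ->
  \sum_(k < p ^ m.+1 | coprime (p ^ m.+1) k) f k =
    \sum_(k < p ^ m.+1) f k - \sum_(j < p ^ m) f (p * j)%N.
Proof.
move=> pr_p; apply/eqP; rewrite eq_sym subr_eq.
rewrite (bigID (fun k : 'I_(p ^ m.+1) => coprime (p ^ m.+1) k)) /=.
apply/eqP; congr (_ + _).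
have p_gt0 := prime_gt0 pr_p.
have lt_mul (j : 'I_(p ^ m)) : (p * j < p ^ m.+1)%N by rewrite expnS ltn_pmul2l.
have lt_div (k : 'I_(p ^ m.+1)) : (k %/ p < p ^ m)%N.
  by rewrite ltn_divLR // mulnC -expnS.
rewrite (reindex_onto (fun j => Ordinal (lt_mul j))
                      (fun k => Ordinal (lt_div k))).
  apply: eq_bigl => j.
  rewrite coprime_pexpl // prime_coprime // negbK dvdn_mulr //=.
  by apply/eqP/val_inj; rewrite /= mulKn.
move=> k; rewrite coprime_pexpl // prime_coprime // negbK => p_dv_k.
by apply: val_inj; rewrite /= muln_divA ?mulKn.
Qed.

(** For g the size of the base field, the left side is the sum of the conjugates
    of z.  Primitivity of g turns it into a sum over the exponents prime to p,
    which is a difference of two full geometric sums, for z and for z^p. *)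
Lemma sum_conj_unity_root (K : fieldType) (g p m : nat) (z : K) :
    prime p -> primitive_root_mod g (p ^ m.+1) -> z ^+ (p ^ m.+1) = 1 ->
  \sum_(i < totient (p ^ m.+1)) z ^+ (g ^ i) =
    (if z == 1 then (p ^ m.+1)%:R else 0) -
    (if z ^+ p == 1 then (p ^ m)%:R else 0).
Proof.
move=> pr_p rootg zN.
have N_gt1 : (1 < p ^ m.+1)%N by rewrite -(exp1n m.+1) ltn_exp2r // prime_gt1.
under eq_bigr do rewrite -(expr_mod _ zN).
rewrite (sum_powers_primitive_root (fun k => z ^+ k)) //.
rewrite (sum_coprime_prime_power m (fun k => z ^+ k)) //.
rewrite sum_unity_root_expr //; congr (_ - _).
under eq_bigr do rewrite exprM.
by rewrite sum_unity_root_expr // -exprM -expnS.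
Qed.

(** * Roots of unity in a finite field *)

(** The solutions are the powers of a primitive k-th root of unity, itself a
    power of a generator of the cyclic group of nonzero elements. *)
Lemma card_unity_roots (F : finFieldType) (k : nat) : (k %| #|F|.-1)%N ->
  #|[set x : F | x ^+ k == 1]| = k.
Proof.
move=> k_dv.
have q1_gt0 : (0 < #|F|.-1)%N by rewrite -subn1 subn_gt0 finNzRing_gt1.
have k_gt0 := dvdn_gt0 q1_gt0 k_dv.
have : has (#|F|.-1).-primitive_root [seq x <- enum F | x != 0].
  apply: has_prim_root => //.
  - apply/allP=> x; rewrite mem_filter => /andP[x_neq0 _].
    rewrite unity_rootE -(can_eq (mulfK x_neq0)) -exprSr prednK.
      by rewrite expf_card mul1r.
    by rewrite ltnW ?finNzRing_gt1.
  - by rewrite filter_uniq // enum_uniq.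
  - rewrite -(cardC1 (0 : F)) cardE /enum_mem -filter_predI.
    by apply/eq_leq/congr1/eq_filter=> x; rewrite /= !inE andbT.
case/hasP=> w _ w_prim.
have z_prim := dvdn_prim_root w_prim k_dv.
set z := w ^+ _ in z_prim.
have -> : [set x : F | x ^+ k == 1] = [set z ^+ val i | i in 'I_k].
  apply/setP=> x; rewrite inE; apply/eqP/imsetP => [|[i _ ->]].
    by case/(prim_rootP z_prim)=> i ->; exists i.
  by rewrite exprAC (prim_expr_order z_prim) expr1n.
rewrite card_imset ?card_ord // => i j /eqP.
by rewrite (eq_prim_root_expr z_prim) !(modn_small (ltn_ord _)) => /eqP/val_inj.
Qed.

(** * Trace codes and their duals *)

Section TraceCode.

Variables (F : finFieldType) (charF : 3%N \in [pchar F]).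
Local Notation K := (pPrimeCharType charF).
Local Notation tr := (tr3 charF).

Lemma tr3_is_zmod_morphism : zmod_morphism (tr : F -> 'F_3).
Proof. by move=> x y; rewrite /tr3 -linearB -raddfB. Qed.

HB.instance Definition _ :=
  GRing.isZmodMorphism.Build F 'F_3 tr tr3_is_zmod_morphism.

(** The Galois group is generated by the cubing map, which rewrites the trace
    as the sum of the iterated cubes of x. *)
Lemma tr3_eq0_sum (e : nat) (x : F) : #|F| = (3 ^ e)%N ->
  (tr x == 0) = (\sum_(i < e) x ^+ (3 ^ i) == 0).
Proof.
move=> cardF.
have -> : (tr x == 0) = ((tr x)%:A == 0 :> K).
  by rewrite scaler_eq0 oner_eq0 orbF.
have dimK : \dim {:K} = e by rewrite pprimeChar_dimf cardF pfactorK.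
rewrite tr3E /galTrace.
have [alpha /eqP gen_alpha alphaE] :=
  @finField_galois_generator _ K 1%AS {:K}%AS (sub1v _).
rewrite gen_alpha sum_cycle orderE -gen_alpha.
have galK : galois 1%AS {:K} by exact: (finField_galois (sub1v _)).
rewrite -(galois_dim galK) dimK dimv1 divn1.
have powE i : (alpha ^+ i)%g (x : K) = x ^+ (3 ^ i).
  elim: i => [|i IHi]; first by rewrite expg0 gal_id expr1.
  rewrite expgSr galM ?memvf // IHi alphaE ?memvf //.
  by rewrite dimv1 expn1 card_Fp // -exprM -expnSr.
by under eq_bigr do rewrite powE.
Qed.

Variable D : {set F}.

(** The encoding map with domain K, the carrier of F that is a vector space
    over 'F_3, so that it can be given a linear structure. *)
Definition trace_encoder (x : K) : 'rV['F_3]_#|D| := trace_codeword charF D x.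

Lemma trace_encoder_is_linear : linear trace_encoder.
Proof.
move=> a x y; apply/rowP=> i; rewrite !mxE.
have -> : a *: x = (x : F) *+ a by rewrite -[RHS]mulr_natl.
by rewrite mulrDr raddfD /= mulrnAr raddfMn /= -mulr_natl natr_Zp.
Qed.

HB.instance Definition _ := GRing.isLinear.Build 'F_3 K 'rV['F_3]_#|D| _
  trace_encoder trace_encoder_is_linear.

Lemma mem_dual_trace_code (u : 'rV['F_3]_#|D|) :
  reflect (forall x : F, \sum_(i < #|D|) u 0 i * tr (enum_val i * x) = 0)
          (u \in dual_code (trace_code charF D)).
Proof.
rewrite inE; apply: (iffP forall_inP) => [du x | du _ /imsetP[x _ ->]].
  rewrite -[RHS](eqP (du _ (imset_f (trace_codeword charF D) (isT : x \in F)))).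
  by apply: eq_bigr => i _; rewrite mxE.
by apply/eqP; rewrite -[RHS](du x); apply: eq_bigr => i _; rewrite mxE.
Qed.

(** The hypothesis says that encoding is injective.  Its matrix then has
    independent rows, so the map f: u |-> u M^T is onto; the dual code is the
    kernel of f, and rank-nullity gives its dimension. *)
Lemma dim_dual_trace_code (e : nat) : #|F| = (3 ^ e)%N ->
    (forall x : F, {in D, forall d, tr (d * x) = 0} -> x = 0) ->
  exists V : {vspace 'rV['F_3]_#|D|},
    dual_code (trace_code charF D) = [set u in V] /\ \dim V = (#|D| - e)%N.
Proof.
move=> cardF injD.
pose M := lin1_mx (trace_encoder \o (@r2v _ K)).
have ME w : w *m M = trace_encoder (r2v w).
  by rewrite mul_rV_lin1.
have freeM : row_free M.
  apply: inj_row_free => w; rewrite ME => cw0.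
  rewrite -[w](@r2vK _ K) [X in v2r X]injD ?linear0 //.
  move=> d dD; have /rowP/(_ (enum_rank_in dD d)) := cw0.
  by rewrite !mxE enum_rankK_in.
pose f : 'Hom('rV['F_3]_#|D|, 'rV['F_3]_(dim K)) := linfun (mulmxr M^T).
exists (lker f); split.
  apply/setP=> u; rewrite [in RHS]inE memv_ker lfunE /=.
  apply/mem_dual_trace_code/eqP => [du | uM x].
    apply/trmx_inj; rewrite trmx_mul trmxK trmx0.
    apply/colP=> k; rewrite !mxE -[RHS](du (r2v (delta_mx 0 k))).
    by apply: eq_bigr => i _; rewrite [RHS]mulrC !mxE.
  have := congr1 (fun A : 'rV_ _ => A *m (v2r (x : K))^T) uM.
  rewrite mul0mx -mulmxA -trmx_mul ME v2rK => /matrixP/(_ 0 0).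
  rewrite [RHS]mxE mxE => uTx; rewrite -[RHS]uTx.
  by apply: eq_bigr => i _; rewrite !mxE.
have full_f : limg f = fullv.
  apply/eqP; rewrite eqEsubv subvf; apply/subvP => w _.
  have w_sub : (w <= M^T)%MS by rewrite submx_full // /row_full mxrank_tr.
  rewrite -(mulmxKpV w_sub); apply/memv_imgP.
  by exists (w *m pinvmx M^T); rewrite ?memvf ?lfunE.
have dimK : dim K = e by rewrite -dimvf pprimeChar_dimf cardF pfactorK.
have := limg_ker_dim f fullv.
rewrite capfv full_f !dimvf => /(canRL (addnK _)) ->.
by congr (_ - _)%N; rewrite -?dimK; apply: mul1n.
Qed.

(** If x were nonzero, H = {z | Tr(z x) = 0} would contain D and 0, and would be
    disjoint from its translate by a = y / x, where z |-> Tr(z x) takes the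
    nonzero value Tr(a x) = Tr(y).  Two disjoint sets of more
    than #|F|/2 elements do not fit in F. *)
Lemma tr3_mul_large_set_eq0 (x : F) : (#|F| <= 2 * #|D|)%N -> 0 \notin D ->
    (exists y, tr y != 0) -> {in D, forall d, tr (d * x) = 0} -> x = 0.
Proof.
move=> largeD D0 [y try] trD; apply/eqP/negPn/negP => x_neq0.
pose H := [set z | tr (z * x) == 0]; pose a := y / x.
have sDH : (0 |: D) \subset H.
  apply/subsetP=> d; rewrite !inE => /predU1P[-> | /trD ->] //.
  by rewrite mul0r raddf0.
have disj : [disjoint H & [set a + z | z in H]].
  rewrite disjoints_subset; apply/subsetP=> z; rewrite !inE => /eqP trz.
  apply/negP=> /imsetP[t]; rewrite inE => /eqP trt def_z.
  case/eqP: try; rewrite -trz def_z mulrDl divfK // raddfD /= trt.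
  by rewrite addr0.
(* H has at least #|D| + 1 elements, which exceeds half of #|F|. *)
have := max_card (mem (H :|: [set a + z | z in H])).
rewrite cardsU disjoint_setI0 // cards0 subn0 card_imset; last exact: addrI.
apply/negP; rewrite -ltnNge addnn -mul2n.
rewrite (leq_ltn_trans largeD) // ltn_pmul2l //.
by have := subset_leq_card sDH; rewrite cardsU1 D0.
Qed.

(** A dual word of weight 1 at d would force Tr(d x) = 0 for all x, which fails
    for x = y / d; the indicator of {d, -d} is a dual word of weight 2, as d and
    -d differ in characteristic 3. *)
Lemma min_dist_dual_trace_code : 0 \notin D -> {in D, forall d, - d \in D} ->
    D != set0 -> (exists y, tr y != 0) ->
  has_min_dist (dual_code (trace_code charF D)) 2.
Proof.
move=> D0 oppD /set0Pn[d dD] [y try]; split.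
  have d_neq0 : d != 0 by apply: contraNneq D0 => <-.
  have ndD := oppD d dD.
  pose i := enum_rank_in dD d; pose j := enum_rank_in ndD (- d).
  have di : enum_val i = d by rewrite enum_rankK_in.
  have dj : enum_val j = - d by rewrite enum_rankK_in.
  have neq_ij : i != j.
    apply: contra_neq d_neq0 => eq_ij.
    have : d *+ 3 = 0 by apply: mulrn_pchar.
    by rewrite mulrS mulr2n -{2}di eq_ij dj addNr addr0.
  pose w : 'rV['F_3]_#|D| := delta_mx 0 i + delta_mx 0 j.
  have wE k : w 0 k = (k == i)%:R + (k == j)%:R by rewrite !mxE eqxx.
  have w_supp k : (w 0 k != 0) = (k \in [set i; j]).
    rewrite wE !inE; case: (eqVneq k i) => [->|_]; last by case: (k == j).
    by rewrite (negPf neq_ij).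
  exists w, 0; split.
  - apply/mem_dual_trace_code=> x.
    rewrite (bigD1 i) //= (bigD1 j) 1?eq_sym //= big1 => [|k /andP[ki kj]].
      rewrite !wE !eqxx (negPf neq_ij) eq_sym (negPf neq_ij) di dj.
      by rewrite addr0 add0r !mul1r addr0 -raddfD /= -mulrDl subrr mul0r raddf0.
    by rewrite wE (negPf ki) (negPf kj) addr0 mul0r.
  - by apply/mem_dual_trace_code=> x; rewrite big1 // => k _; rewrite mxE mul0r.
  - apply/eqP=> /rowP/(_ i)/eqP; rewrite [X in _ == X]mxE.
    by apply/negP; rewrite w_supp !inE eqxx.
  - rewrite /hamming_dist -[RHS](_ : #|[set i; j]| = 2).
      by apply: eq_card => k; rewrite inE [X in _ != X]mxE w_supp.
    by rewrite cards2 neq_ij.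
move=> u v /mem_dual_trace_code du /mem_dual_trace_code dv neq_uv.
have /rV0Pn[i] : u - v != 0 by rewrite subr_eq0.
rewrite !mxE subr_eq0 => uvi.
rewrite ltnNge; apply/negP=> dist_le1.
pose x := y / enum_val i.
have di_neq0 : enum_val i != 0 by apply: contraNneq D0 => <-; apply: enum_valP.
have : \sum_k (u 0 k - v 0 k) * tr (enum_val k * x) = 0.
  by under eq_bigr do rewrite mulrBl; rewrite sumrB du dv subrr.
rewrite (bigD1 i) //= big1 ?addr0 => [|k neq_ki]; last first.
  apply/eqP; rewrite mulf_eq0 subr_eq0; apply/orP; left.
  apply: contraTT dist_le1 => uvk; rewrite -ltnNge.
  rewrite /hamming_dist (cardsD1 i) (cardsD1 k) !inE uvi uvk neq_ki.
  by [].
rewrite mulrCA divff // mulr1 => /eqP.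
by rewrite mulf_eq0 (negPf try) orbF subr_eq0 (negPf uvi).
Qed.

End TraceCode.

(** * The defining set cut out by the trace of a power *)

Section UnityRoots.

Variables (F : finFieldType) (charF : 3%N \in [pchar F]) (p m : nat).
Hypotheses (pr_p : prime p) (root3 : primitive_root_mod 3 (p ^ m.+1)).
Hypothesis cardF : #|F| = (3 ^ totient (p ^ m.+1))%N.
Hypothesis p_coprime3 : ~~ (3 %| p)%N.
Local Notation N := (p ^ m.+1)%N.
Local Notation tr := (tr3 charF).

(** In the formula Tr(z) = N [z = 1] - (N/p) [z^p = 1], the value at z = 1 is
    (N/p) (p - 1), and it is - N/p at the other z with z^p = 1; only the former
    can vanish modulo 3. *)
Lemma tr3_unity_root_eq0 (z : F) : z ^+ N = 1 ->
  (tr z == 0) = (z ^+ p != 1) || ((z == 1) && (p %% 3 == 1)%N).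
Proof.
move=> zN; rewrite (tr3_eq0_sum _ _ cardF) sum_conj_unity_root //.
have pm_neq0 : (p ^ m)%:R != 0 :> F.
  by rewrite -(dvdn_pcharf charF) Euclid_dvdX // (negPf p_coprime3).
case: (eqVneq z 1) => [->|z_neq1]; last first.
  by rewrite sub0r oppr_eq0; case: ifP; rewrite ?eqxx ?(negPf pm_neq0).
rewrite expr1n eqxx /= expnSr natrM -[X in _ - X]mulr1 -mulrBr mulf_eq0.
rewrite (negPf pm_neq0) -(natrB _ (prime_gt0 pr_p)) -(dvdn_pcharf charF).
by rewrite -eqn_mod_dvd ?prime_gt0.
Qed.

(** The set is the complement, among the nonzero x, of the roots of x^(k p) = 1,
    to which the roots of x^k = 1 are added back when p = 1 mod 3. *)
Lemma card_tr3_power_eq0 (k : nat) : #|F|.-1 = (k * N)%N ->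
  #|[set x : F | (x != 0) && (tr (x ^+ k) == 0)]| =
    (k * (N - p + (p %% 3 == 1)))%N.
Proof.
move=> cardF1.
have q1_gt0 : (0 < #|F|.-1)%N by rewrite -subn1 subn_gt0 finNzRing_gt1.
have kN_gt0 : (0 < k * N)%N by rewrite -cardF1.
have k_gt0 : (0 < k)%N by move: kN_gt0; rewrite muln_gt0 => /andP[].
have p_gt0 := prime_gt0 pr_p.
pose A := [set x : F | x ^+ (k * p) == 1].
pose B := [set x : F | x ^+ k == 1].
have cardA : #|A| = (k * p)%N.
  by rewrite card_unity_roots // cardF1 dvdn_pmul2l // expnS dvdn_mulr.
have cardB : #|B| = k by rewrite card_unity_roots // cardF1 dvdn_mulr.
have A_neq0 : A \subset [set~ 0].
  apply/subsetP=> x; rewrite !inE; apply: contraTneq => ->.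
  by rewrite expr0n gtn_eqF ?muln_gt0 ?k_gt0 // eq_sym oner_eq0.
have sBA : B \subset A.
  by apply/subsetP=> x; rewrite !inE exprM => /eqP->; rewrite expr1n.
have -> : [set x : F | (x != 0) && (tr (x ^+ k) == 0)] =
    ([set~ 0] :\: A) :|: (if (p %% 3 == 1)%N then B else set0).
  apply/setP=> x; rewrite !inE.
  have [->|x_neq0] := eqVneq x 0.
    rewrite andbF; case: ifP => _; rewrite !inE ?expr0n //.
    by rewrite (gtn_eqF k_gt0) [_ == 1]eq_sym oner_eq0.
  have xkN : (x ^+ k) ^+ N = 1.
    rewrite -exprM -cardF1; apply: (mulIf x_neq0).
    by rewrite -exprSr prednK ?expf_card ?mul1r // ltnW ?finNzRing_gt1.
  rewrite tr3_unity_root_eq0 // -exprM andbT.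
  by case: ifP; rewrite ?andbT ?andbF !inE.
rewrite cardsU (_ : _ :&: _ = set0); last first.
  apply/setP=> x; rewrite in_set0; apply/negP; rewrite !inE.
  case/andP=> /andP[xA _]; case: ifP; rewrite ?inE // => _ xB.
  by case/negP: xA; have := subsetP sBA x; rewrite !inE; apply.
rewrite cards0 subn0 cardsD (setIidPr A_neq0) cardA cardsC1 cardF1 -mulnBr.
by rewrite mulnDr; case: ifP; rewrite ?cards0 ?cardB ?muln1 ?muln0.
Qed.

End UnityRoots.

(** Both congruence classes of p at once: the boolean (p %% 3 == 1) contributes
    the extra k elements of D. *)
Lemma dual_trace_code_params (F : finFieldType) (charF : 3%N \in [pchar F])
    (p m k : nat) :
    prime p -> odd p -> primitive_root_mod 3 (p ^ m.+2) -> ~~ (3 %| p)%N ->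
    #|F| = (3 ^ totient (p ^ m.+2))%N -> #|F|.-1 = (k * p ^ m.+2)%N ->
  let D := [set x : F | (x != 0) && (tr3 charF (x ^+ k) == 0)] in
  let n := (k * (p ^ m.+2 - p + (p %% 3 == 1)))%N in
  ternary_code (dual_code (trace_code charF D)) n (n - totient (p ^ m.+2)) 2.
Proof.
move=> pr_p p_odd root3 p3 cardF cardF1 D n.
have cardD : #|D| = n by apply: card_tr3_power_eq0.
have q1_gt0 : (0 < #|F|.-1)%N by rewrite -subn1 subn_gt0 finNzRing_gt1.
have p_gt2 : (2 < p)%N by rewrite odd_prime_gt2.
have k_gt0 : (0 < k)%N.
  by move: q1_gt0; rewrite cardF1 muln_gt0 => /andP[].
have largeN : (3 * p <= p ^ m.+2)%N.
  rewrite expnSr leq_mul2r (leq_trans p_gt2) ?orbT // expnS leq_pmulr //.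
  by rewrite expn_gt0 prime_gt0.
(* A zero trace would make D all of the k p^(m+2) nonzero elements. *)
have [y try] : exists y, tr3 charF y != 0.
  apply/existsP; apply: contraT; rewrite negb_exists => /forallP tr0.
  have : #|D| = #|[set~ (0 : F)]|.
    congr #|pred_of_set _|; apply/setP=> x.
    by rewrite !inE (negPn (tr0 _)) andbT.
  rewrite cardD cardsC1 cardF1 => /eqP; rewrite eqn_pmul2l // => /eqP.
  move: (p ^ m.+2)%N largeN => N; case: (_ == _) => /=; lia.
have largeD : (#|F| <= 2 * #|D|)%N.
  rewrite cardD -(prednK (ltnW (finNzRing_gt1 F))) cardF1 /n mulnCA.
  rewrite (@leq_trans (k * (p ^ m.+2).+1)) //.
    by rewrite mulnS addnC -addn1 leq_add2l.
  rewrite leq_mul2l; apply/orP; right.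
  move: (p ^ m.+2)%N largeN => N; case: (_ == _) => /=; lia.
have D0 : 0 \notin D by rewrite inE eqxx.
split=> //.
- have [|V [dualE dimV]] := @dim_dual_trace_code F charF D _ cardF.
    by move=> x; apply: tr3_mul_large_set_eq0 => //; exists y.
  by exists V; split; rewrite // -cardD.
- apply: min_dist_dual_trace_code => //; last by exists y.
    move=> d; rewrite !inE oppr_eq0 => /andP[-> trd] /=.
    (* (-d)^k is d^k up to sign, which does not affect a vanishing trace. *)
    rewrite exprNn -signr_odd; case: odd; rewrite ?mul1r // mulN1r raddfN /=.
    by rewrite oppr_eq0.
  by rewrite -card_gt0; move: largeD (finNzRing_gt1 F); lia.
Qed.

Theorem theorem5p1 (m p : nat) (m_gt1 : (1 < m)%N)
    (p_prime : prime p) (p_odd : odd p)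
    (root3 : primitive_root_mod 3 (p ^ m))
    (F : finFieldType) (cardF : #|F| = (3 ^ totient (p ^ m))%N) :
  let q := (3 ^ totient (p ^ m))%N in
  let charF : 3%N \in [pchar F] := card_finPcharP cardF (erefl : prime 3) in
  let D : {set F} :=
    [set x : F | (x != 0) && (tr3 charF (x ^+ ((q - 1) %/ p ^ m)) == 0)] in
  let params (n : nat) :=
    ternary_code (dual_code (trace_code charF D))
      n (n - p ^ (m - 1) * (p - 1))%N 2 in
  (p = 1 %[mod 3] -> params ((q - 1) %/ p ^ m * (p ^ m - p + 1))%N) /\
  (p = 2 %[mod 3] -> params ((q - 1) %/ p ^ m * (p ^ m - p))%N).
Proof.
move=> q charF D params.
case: m m_gt1 root3 cardF @q charF @D @params => [|[|m]] // _ root3 cardF.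
move=> q charF D params.
have main : ~~ (3 %| p)%N ->
    params ((q - 1) %/ p ^ m.+2 * (p ^ m.+2 - p + (p %% 3 == 1)))%N.
  move=> p3; rewrite /params.
  have -> : (p ^ (m.+2 - 1) * (p - 1) = totient (p ^ m.+2))%N.
    by rewrite totient_pfactor // mulnC !subn1.
  apply: dual_trace_code_params => //; rewrite divnK ?cardF ?subn1 //.
  (* Euler: 3 being prime to N = p^(m+2), N divides 3^(totient N) - 1. *)
  have co : coprime 3 (p ^ m.+2) by rewrite coprime_pexpr // prime_coprime.
  by rewrite -subn1 -eqn_mod_dvd ?expn_gt0 //; apply/eqP/Euler_exp_totient.
split=> p_mod3; move: main; rewrite /dvdn p_mod3 => /(_ isT) //.
by rewrite addn0.
Qed.
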